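(* Let $\mathcal{E}$ be a complex Hilbert space and let $\varphi:\mathcal{E}\to\mathcal{E}$ satisfy property $\mathcal{P}$, with associated $A$, $b$, $v$. Then the following are true: (1) Let $z\in\mathcal{E}$. Then $C_\varphi^*$ attains its norm at $\frac{K_z}{\|K_z\|}$ if and only if $v=(I-A^*A)^{1/2}z$. (2) $C_\varphi$ is norm attaining provided $v$ is in the range of $(I-A^*A)^{1/2}$. (3) $C_\varphi^*$ attains its norm at $\frac{K_z}{\|K_z\|}$ for every $z\in\mathcal{E}$ if and only if the linear operator $A$ is an isometry on $\mathcal{E}$.
   Context: Inner products are linear in the first variable. For a complex Hilbert space $\mathcal{E}$, the Segal-Bargmann space $\mathcal{H}(\mathcal{E})$ is the reproducing kernel Hilbert space of (entire) functions on $\mathcal{E}$ with reproducing kernel $K(z,w)=K_w(z)=\exp\langle z,w\rangle$, $z,w\in\mathcal{E}$; thus $\langle f,K_w\rangle=f(w)$ for $f\in\mathcal{H}(\mathcal{E})$. For a mapping $\varphi:\mathcal{E}\to\mathcal{E}$, the composition operator is $C_\varphi f=f\circ\varphi$. The map $\varphi$ has property $\mathcal{P}$ if: (i) $\varphi(z)=Az+b$ for all $z\in\mathcal{E}$; (ii) $A:\mathcal{E}\to\mathcal{E}$ is a bounded linear operator with $\|A\|\le 1$ and $b\in\mathcal{E}$; (iii) $A^*b$ belongs to the range of $(I-A^*A)^{1/2}$, and $v$ denotes the unique element of $\mathcal{E}$ of smallest norm such that $(I-A^*A)^{1/2}v=A^*b$. Property $\mathcal{P}$ is equivalent to boundedness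 of $C_\varphi$ on $\mathcal{H}(\mathcal{E})$. A bounded operator $T$ on a Hilbert space attains its norm at a unit vector $x$ if $\|Tx\|=\|T\|$; $T$ is norm attaining if such a unit vector exists. *)

(* Defs.v *)
From HB Require Import structures.
From mathcomp Require Import all_boot all_order all_algebra.
From mathcomp Require Import complex.
From mathcomp Require Import boolp classical_sets reals topology normedtype.
From mathcomp Require Import sequences exp trigo.

Set Implicit Arguments.
Unset Strict Implicit.
Unset Printing Implicit Defensive.

Import Order.TTheory GRing.Theory Num.Theory.
Import numFieldNormedType.Exports.

Local Open Scope classical_set_scope.
Local Open Scope ring_scope.
Local Open Scope complex_scope.

(* The inner product is linear in the first variable; positive definiteness
   is contained in [inner_norm]. The norm [`|x|] takes its values in R[i]. *)
HB.mixin Record CompleteNormedModule_isHilbert (R : realType) E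
    of CompleteNormedModule R[i] E := {
  inner : E -> E -> R[i];
  inner_linearl : forall (a : R[i]) (x y z : E),
    inner (a *: x + y) z = a * inner x z + inner y z;
  inner_conj : forall x y : E, inner y x = (inner x y)^*;
  inner_norm : forall x : E, inner x x = `|x| ^+ 2
}.

#[short(type="hilbertType")]
HB.structure Definition Hilbert (R : realType) :=
  {E of CompleteNormedModule R[i] E & CompleteNormedModule_isHilbert R E}.

Notation "'<<|' x , y '|>>'" := (inner x y)
  (at level 0, x, y at level 99, format "<<| x ,  y |>>") : ring_scope.

Section Operators.
Context {R : realType}.

Definition hnorm {E : hilbertType R} (x : E) : R := complex.Re `|x|.

Lemma hnormE (E : hilbertType R) (x : E) : (hnorm x)%:C = `|x|.
Proof. by rewrite /hnorm RRe_real // normr_real. Qed.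

Definition bounded_operator {E F : hilbertType R} (T : E -> F) : Prop :=
  linear T /\ exists M : R, forall x, hnorm (T x) <= M * hnorm x.

(* Meaningful only for bounded operators: the real [sup] of an unbounded set
   is a default value. *)
Definition opnorm {E F : hilbertType R} (T : E -> F) : R :=
  sup [set hnorm (T x) | x in [set x | hnorm x <= 1]].

Definition isometric {E F : hilbertType R} (T : E -> F) : Prop :=
  forall x, hnorm (T x) = hnorm x.

Definition adjoint {E F : hilbertType R} (T : E -> F) (y : F) : E :=
  xget 0 [set x | forall z, <<| T z, y |>> = <<| z, x |>>].

(* [0 <= c] in R[i] forces c to be real, so a positive operator is
   self-adjoint. *)
Definition positive_operator {E : hilbertType R} (T : E -> E) : Prop :=
  bounded_operator T /\ forall x, 0 <= <<| T x, x |>>.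

Definition sqrt_operator {E : hilbertType R} (T : E -> E) : E -> E :=
  xget (fun=> 0) [set S | positive_operator S /\ forall x, S (S x) = T x].

Definition attains_norm_at {E F : hilbertType R} (T : E -> F) (x : E) : Prop :=
  [/\ bounded_operator T, hnorm x = 1 & hnorm (T x) = opnorm T].

Definition norm_attaining {E F : hilbertType R} (T : E -> F) : Prop :=
  exists x, attains_norm_at T x.

(* A Hilbert space of functions on X; injectivity of [rkhs_fun] identifies
   its points with functions. *)
Record rkhs (X : Type) (K : X -> X -> R[i]) := RKHS {
  rkhs_space :> hilbertType R;
  rkhs_fun : rkhs_space -> X -> R[i];
  rkhs_fun_linear : forall (a : R[i]) (f g : rkhs_space) (x : X),
    rkhs_fun (a *: f + g) x = a * rkhs_fun f x + rkhs_fun g x;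
  rkhs_fun_inj : injective rkhs_fun;
  rkhs_kernel : X -> rkhs_space;
  rkhs_kernelE : forall w z : X, rkhs_fun (rkhs_kernel w) z = K z w;
  rkhs_reproducing : forall (f : rkhs_space) (w : X),
    <<| f, rkhs_kernel w |>> = rkhs_fun f w
}.

Definition composition_operator (X : Type) (K : X -> X -> R[i]) (H : rkhs K)
    (phi : X -> X) (f : H) : H :=
  xget 0 [set g : H | rkhs_fun g = rkhs_fun f \o phi].

Lemma composition_operatorE (X : Type) (K : X -> X -> R[i]) (H : rkhs K)
    (phi : X -> X) (f : H) :
  (exists g : H, rkhs_fun g = rkhs_fun f \o phi) ->
  rkhs_fun (composition_operator phi f) = rkhs_fun f \o phi.
Proof.
move=> [g gE]; rewrite /composition_operator.
exact: (@xgetPex _ 0 [set g : H | rkhs_fun g = rkhs_fun f \o phi] (ex_intro _ g gE)).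
Qed.

Definition normalized_kernel (X : Type) (K : X -> X -> R[i]) (H : rkhs K)
    (z : X) : H :=
  `|rkhs_kernel H z|^-1 *: rkhs_kernel H z.

Definition cexp (z : R[i]) : R[i] :=
  (expR (complex.Re z))%:C
  * (cos (complex.Im z) +i* sin (complex.Im z)).

Definition segal_bargmann (E : hilbertType R) : Type :=
  rkhs (fun z w : E => cexp <<| z, w |>>).

Definition defect {E : hilbertType R} (A : E -> E) : E -> E :=
  sqrt_operator (fun x => x - adjoint A (A x)).

Definition property_P {E : hilbertType R} (phi : E -> E) (A : E -> E) (b : E) :
    Prop :=
  [/\ forall z, phi z = A z + b,
      bounded_operator A,
      opnorm A <= 1 &
      range (defect A) (adjoint A b)].

Definition is_min_norm_solution {E F : hilbertType R} (T : E -> F) (y : F)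
    (v : E) : Prop :=
  T v = y /\ forall u, T u = y -> hnorm v <= hnorm u.

End Operators.

(* Main.v *)
Require Import Defs.
From mathcomp Require Import all_boot all_order all_algebra.
From mathcomp Require Import complex.
From mathcomp Require Import boolp classical_sets reals topology normedtype.
From mathcomp Require Import interval_inference sequences exp trigo ring lra.

(** Write S for the positive square root of I - A^* A, and c = |v|^2 + |b|^2.
    Since A^* b = S v, expanding the inner products gives

      <phi z, phi w> + <S z - v, S w - v> = <z, w> + c,

    and this identity ([affine_defect_inner]) carries the whole result.

    On the diagonal, together with C^* K_z = K_(phi z) and |K_z|^2 = exp |z|^2,
    it says that C^* sends the normalized kernel at z to a vector of norm
    exp ((c - |S z - v|^2) / 2).

    Off the diagonal it bounds C. Exponentiating, exp c times the Gram matrix of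
    the K_z minus the Gram matrix of the K_(phi z) has the entries
    exp <phi z, phi w> (exp <u z, u w> - 1) with u z = S z - v. Both factors are
    Gram matrices in the Segal-Bargmann space itself, of the K_(phi z) and of
    the K_(u z) - K_0, so by the Schur product theorem ([schur_gram_ge0]) the
    difference is positive semidefinite. Hence K_z |-> K_(phi z) extends to an
    operator of norm at most exp (c / 2), whose adjoint is C
    ([composition_exists]).

    Minimality of |v| puts v in the closure of the range of S
    ([min_norm_in_closure]), so |S z - v| is arbitrarily small and the norm of C
    is exactly exp (c / 2). Then C^* attains its norm at the normalized kernel
    of z exactly when S z = v. When some z satisfies this, C attains its norm
    too, at the normalization of the image under C^*
    ([norm_attaining_of_adjoint]). Finally S z = v for all z forces v = S 0 = 0
    and S = 0, and S = 0 means that A is an isometry because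
    |A z|^2 + |S z|^2 = |z|^2; conversely, if S = 0 then minimality gives v = 0.

    Two facts about Hilbert spaces support this. Riesz representation is proved
    for functionals given as linear relations ([riesz_relation]); this single
    form yields adjoints, the values of C, and the closure statement about v.
    Existence of S comes from a fixed point iteration whose terms are
    polynomials in A^* A with nonnegative coefficients ([sqrt_exists]). *)

Set Implicit Arguments.
Unset Strict Implicit.
Unset Printing Implicit Defensive.

Import Order.TTheory GRing.Theory Num.Theory.
Import numFieldNormedType.Exports.

Local Open Scope classical_set_scope.
Local Open Scope ring_scope.
Local Open Scope complex_scope.

(** * Inner products and norms *)

Lemma pos_complexP (R : realType) (e : R[i]) :
  0 < e -> exists2 r : R, 0 < r & e = r%:C.
Proof.
rewrite ltcE => /andP[/eqP ie re]; exists (complex.Re e) => //.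
by move: ie; case: e {re} => ? ? /= ->.
Qed.

Section InnerProduct.
Context {R : realType} {E : hilbertType R}.
Implicit Types (x y z : E) (a : R[i]) (t : R).

Lemma innerDl x y z : <<| x + y, z |>> = <<| x, z |>> + <<| y, z |>>.
Proof. by rewrite -[x in LHS]scale1r inner_linearl mul1r. Qed.

Lemma inner0l z : <<| (0 : E), z |>> = 0.
Proof. by apply: (addrI <<| (0 : E), z |>>); rewrite -innerDl !addr0. Qed.

Lemma innerZl a x z : <<| a *: x, z |>> = a * <<| x, z |>>.
Proof. by rewrite -[a *: x]addr0 inner_linearl inner0l addr0. Qed.

Lemma innerNl x z : <<| - x, z |>> = - <<| x, z |>>.
Proof. by rewrite -scaleN1r innerZl mulN1r. Qed.

Lemma innerBl x y z : <<| x - y, z |>> = <<| x, z |>> - <<| y, z |>>.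
Proof. by rewrite innerDl innerNl. Qed.

Lemma innerDr x y z : <<| z, x + y |>> = <<| z, x |>> + <<| z, y |>>.
Proof. by rewrite inner_conj innerDl rmorphD /= -!inner_conj. Qed.

Lemma inner0r z : <<| z, (0 : E) |>> = 0.
Proof. by rewrite inner_conj inner0l conjc0. Qed.

Lemma innerZr a x z : <<| z, a *: x |>> = conjc a * <<| z, x |>>.
Proof. by rewrite inner_conj innerZl rmorphM /= -inner_conj. Qed.

Lemma innerNr x z : <<| z, - x |>> = - <<| z, x |>>.
Proof. by rewrite inner_conj innerNl rmorphN /= -inner_conj. Qed.

Lemma innerBr x y z : <<| z, x - y |>> = <<| z, x |>> - <<| z, y |>>.
Proof. by rewrite innerDr innerNr. Qed.

Lemma inner_suml (I : Type) (s : seq I) (f : I -> E) z :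
  <<| \sum_(i <- s) f i, z |>> = \sum_(i <- s) <<| f i, z |>>.
Proof.
elim: s => [|i s IHs]; first by rewrite !big_nil inner0l.
by rewrite !big_cons innerDl IHs.
Qed.

Lemma inner_sumr (I : Type) (s : seq I) (f : I -> E) z :
  <<| z, \sum_(i <- s) f i |>> = \sum_(i <- s) <<| z, f i |>>.
Proof.
elim: s => [|i s IHs]; first by rewrite !big_nil inner0r.
by rewrite !big_cons innerDr IHs.
Qed.

(** The underlying real inner product: it turns norm estimates into real
    arithmetic. *)
Definition rinner x y : R := complex.Re <<| x, y |>>.

Lemma rinnerC x y : rinner x y = rinner y x.
Proof. by rewrite /rinner inner_conj; case: <<| y, x |>>. Qed.

Lemma rinnerDl x y z : rinner (x + y) z = rinner x z + rinner y z.
Proof. by rewrite /rinner innerDl raddfD. Qed.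

Lemma rinnerNl x z : rinner (- x) z = - rinner x z.
Proof. by rewrite /rinner innerNl raddfN. Qed.

Lemma rinnerZl t x z : rinner (t%:C *: x) z = t * rinner x z.
Proof. by rewrite /rinner innerZl; case: <<| x, z |>> => u w /=; rewrite mul0r subr0. Qed.

Lemma rinnerDr x y z : rinner z (x + y) = rinner z x + rinner z y.
Proof. by rewrite rinnerC rinnerDl !(rinnerC z). Qed.

Lemma rinnerNr x z : rinner z (- x) = - rinner z x.
Proof. by rewrite rinnerC rinnerNl rinnerC. Qed.

Lemma rinnerZr t x z : rinner z (t%:C *: x) = t * rinner z x.
Proof. by rewrite rinnerC rinnerZl rinnerC. Qed.

Definition rinnerE := (rinnerDl, rinnerDr, rinnerNl, rinnerNr, rinnerZl, rinnerZr).

Lemma inner_hnorm x : <<| x, x |>> = (hnorm x ^+ 2)%:C.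
Proof. by rewrite inner_norm -hnormE rmorphXn. Qed.

Lemma rinner_hnorm x : rinner x x = hnorm x ^+ 2.
Proof. by rewrite /rinner inner_hnorm. Qed.

Lemma hnorm_ge0 x : 0 <= hnorm x.
Proof. by rewrite -ler0c hnormE. Qed.

Lemma hnorm0 : hnorm (0 : E) = 0.
Proof. by rewrite /hnorm normr0. Qed.

Lemma hnorm_eq0 x : (hnorm x == 0) = (x == 0).
Proof.
apply/eqP/eqP => [h|->]; last exact: hnorm0.
by apply/eqP; rewrite -normr_eq0 -hnormE h.
Qed.

Lemma hnormZ t x : hnorm (t%:C *: x) = `|t| * hnorm x.
Proof.
apply: complexI; rewrite rmorphM /= !hnormE normrZ; congr (_ * _).
by rewrite normc_def /= expr0n addr0 sqrtr_sqr.
Qed.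

Lemma hnorm_opp x : hnorm (- x) = hnorm x.
Proof. by rewrite /hnorm normrN. Qed.

Lemma hnorm_distC x y : hnorm (x - y) = hnorm (y - x).
Proof. by rewrite -hnorm_opp opprB. Qed.

Lemma hnormD_le x y : hnorm (x + y) <= hnorm x + hnorm y.
Proof. by rewrite -lecR rmorphD /= !hnormE ler_normD. Qed.

Lemma hnorm_tri x y z : hnorm (x - z) <= hnorm (x - y) + hnorm (y - z).
Proof. by apply: le_trans (hnormD_le _ _); rewrite addrA subrK. Qed.

Lemma hnormD2 x y : hnorm (x + y) ^+ 2 = hnorm x ^+ 2 + hnorm y ^+ 2 + 2 * rinner x y.
Proof. by rewrite -!rinner_hnorm !rinnerE (rinnerC y); ring. Qed.

(** Cauchy-Schwarz, read off from the triangle inequality for [x + y], since the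
    norm is already known to be a norm. *)
Lemma rinner_le x y : rinner x y <= hnorm x * hnorm y.
Proof.
have := hnormD_le x y; have := hnormD2 x y.
have := hnorm_ge0 (x + y); have := hnorm_ge0 x; have := hnorm_ge0 y.
nra.
Qed.

Lemma rinner_abs_le x y : `|rinner x y| <= hnorm x * hnorm y.
Proof.
rewrite ler_norml rinner_le andbT lerNl -rinnerNl -[hnorm x]hnorm_opp.
exact: rinner_le.
Qed.

Lemma hnorm_cvgP (u : nat -> E) l :
  u n @[n --> \oo] --> l <->
  forall e : R, 0 < e -> exists N, forall n, (N <= n)%N -> hnorm (u n - l) < e.
Proof.
split=> [/cvgrPdist_lt ul e e0 | ul].
  have [|N _ hN] := ul e%:C; first by rewrite ltcR.
  by exists N => n Nn; have := hN n Nn; rewrite /= -hnormE ltcR hnorm_distC.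
apply/cvgrPdist_lt => e /pos_complexP[r r0 ->].
have [N hN] := ul r r0; exists N => // n Nn.
by rewrite -hnormE ltcR hnorm_distC hN.
Qed.

Lemma hnorm_cauchy (u : nat -> E) :
  (forall e : R, 0 < e -> exists N, forall n, (N <= n)%N -> hnorm (u N - u n) < e) ->
  exists l : E, u n @[n --> \oo] --> l.
Proof.
move=> hu; apply/cvg_ex/cauchy_cvgP/cauchy_exP => e /pos_complexP[r r0 ->].
have [N hN] := hu _ r0; exists (u N); exists N => // n /= Nn.
by rewrite -ball_normE /ball_ /= -hnormE ltcR hN.
Qed.

End InnerProduct.

(** * Riesz representation *)

Lemma le_of_eps (R : realType) (c x y : R) :
  (forall e, 0 < e -> x <= y + e * c) -> x <= y.
Proof.
move=> h; rewrite leNgt; apply/negP => yx.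
have c0 : 0 < c by have := h 1 ltr01; lra.
have d0 : 0 < (x - y) / (2 * c) by rewrite divr_gt0; lra.
have := h _ d0.
have -> : (x - y) / (2 * c) * c = (x - y) / 2 by field; lra.
lra.
Qed.

Section Riesz.
Context {R : realType} {E : hilbertType R}.

(** The functional is given as a linear relation [G], so that it may be prescribed
    on formal combinations of vectors without a prior proof that it is well
    defined; the bound makes it single-valued. The representing vector [g]
    minimises [J x c = |x|^2 - 2 Re c], which equals [|x - g|^2 - |g|^2] when
    [c = <x, g>]; minimising sequences are Cauchy by the parallelogram identity,
    and [g] is their limit, hence in the closure of the domain of [G]. *)
Theorem riesz_relation (G : E -> R[i] -> Prop) (M : R) :
  0 <= M -> G 0 0 ->
  (forall a x y c d, G x c -> G y d -> G (a *: x + y) (a * c + d)) ->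
  (forall x c, G x c -> complex.Re c <= M * hnorm x) ->
  exists g, [/\ forall x c, G x c -> <<| x, g |>> = c, hnorm g <= M &
    forall e : R, 0 < e -> exists x c, G x c /\ hnorm (x - g) < e].
Proof.
move=> M0 G0 Glin GM.
pose J (x : E) (c : R[i]) : R := hnorm x ^+ 2 - 2 * complex.Re c.
pose V := [set r | exists x c, G x c /\ r = J x c].
have lbV : has_lbound V.
  exists (- M ^+ 2) => _ [x [c [Gxc ->]]]; rewrite /J.
  have := GM x c Gxc; have := sqr_ge0 (hnorm x - M); nra.
have V0 : V !=set0 by exists (J 0 0), 0, 0.
pose I := inf V.
have J_ge x c : G x c -> I <= J x c by move=> Gxc; apply: ge_inf => //; exists x, c.
have J_lt e : 0 < e -> exists x c, G x c /\ J x c < I + e.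
  by move=> e0; have [_ [x [c [Gxc ->]]] lt] := inf_adherent e0 (conj V0 lbV); exists x, c.
(* The midpoint of two near-minimisers cannot go below the infimum. *)
have near x c y d e : G x c -> G y d -> J x c <= I + e -> J y d <= I + e ->
    hnorm (x - y) ^+ 2 <= 4 * e.
  move=> Gx Gy hx hy.
  have Gz : G (2^-1%:C *: x + (2^-1%:C *: y + 0)) (2^-1%:C * c + (2^-1%:C * d + 0)).
    by apply: (Glin) => //; apply: (Glin).
  have := J_ge _ _ Gz; rewrite !addr0.
  move: hx hy; rewrite /J -!rinner_hnorm !rinnerE (rinnerC y x).
  have -> : complex.Re (2^-1%:C * c + 2^-1%:C * d) =
      2^-1 * complex.Re c + 2^-1 * complex.Re d.
    by case: c {Gx Gz} => ? ?; case: d {Gy} => ? ? /=; rewrite !mul0r !subr0.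
  lra.
pose eps n : R := n.+1%:R^-1.
have eps0 n : 0 < eps n by rewrite invr_gt0 ltr0n.
have /choice [xc hxc] : forall n, exists p : E * R[i], G p.1 p.2 /\ J p.1 p.2 < I + eps n.
  by move=> n; have [x [c h]] := J_lt _ (eps0 n); exists (x, c).
have epsN e : 0 < e -> exists N, forall n, (N <= n)%N -> eps n < e.
  move=> e0; have [N _ hN] := near_infty_natSinv_lt (PosNum e0).
  by exists N => n /hN.
have eps_le m n : (m <= n)%N -> eps n <= eps m.
  by move=> mn; rewrite lef_pV2 ?posrE ?ltr0n ?ler_nat.
have [e e0|g /hnorm_cvgP hg] := @hnorm_cauchy R E (fun n => (xc n).1).
  have [|N hN] := epsN (e ^+ 2 / 4); first by rewrite divr_gt0 ?exprn_gt0.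
  exists N => n Nn.
  have [G1 J1] := hxc N; have [G2 J2] := hxc n.
  rewrite -(@ltr_pXn2r _ 2) ?nnegrE ?hnorm_ge0 ?(ltW e0) //.
  apply: (@le_lt_trans _ _ (4 * eps N)); last by have := hN N (leqnn _); lra.
  apply: near G1 G2 (ltW J1) _; have := eps_le _ _ Nn; lra.
have approx e : 0 < e -> exists x c, [/\ G x c, J x c <= I + e & hnorm (x - g) < e].
  move=> e0; have [N1 h1] := epsN _ e0; have [N2 h2] := hg _ e0.
  have [G1 J1] := hxc (maxn N1 N2).
  exists (xc (maxn N1 N2)).1, (xc (maxn N1 N2)).2; split => //.
    by have := h1 _ (leq_maxl N1 N2); lra.
  exact: h2 (leq_maxr _ _).
have key y d : G y d -> rinner y g = complex.Re d.
  move=> Gy.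
  (* First-order condition at the minimiser in the direction of [y]. *)
  have pos t : 0 <= 2 * t * (rinner y g - complex.Re d) + t ^+ 2 * hnorm y ^+ 2.
    apply: (@le_of_eps _ (1 + 2 * `|t| * hnorm y)) => e e0.
    have [x [c [Gx Jx xg]]] := approx _ e0.
    have := J_ge _ _ (Glin t%:C _ _ _ _ Gy Gx).
    move: Jx; rewrite /J -!rinner_hnorm !rinnerE (rinnerC x y).
    have -> : complex.Re (t%:C * d + c) = t * complex.Re d + complex.Re c.
      by case: d {Gy} => ? ?; case: c {Gx} => ? ? /=; rewrite mul0r subr0.
    have : `|t| * `|rinner y (x - g)| <= `|t| * (hnorm y * e).
      apply: ler_wpM2l => //; apply: le_trans (rinner_abs_le _ _) _.
      by apply: ler_wpM2l (ltW xg); exact: hnorm_ge0.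
    rewrite -normrM ler_norml !rinnerE => /andP[? ?]; lra.
  pose r := rinner y g - complex.Re d; pose n := hnorm y ^+ 2.
  have n0 : 0 <= n by exact: sqr_ge0.
  have := pos (- r / (n + 1)); rewrite -/r -/n => h.
  have : 0 <= - r ^+ 2 * (n + 2).
    have -> : - r ^+ 2 * (n + 2) =
       (2 * (- r / (n + 1)) * r + (- r / (n + 1)) ^+ 2 * n) * (n + 1) ^+ 2 by field; lra.
    by rewrite mulr_ge0 ?sqr_ge0.
  have := sqr_ge0 r => r2 h2; have : r ^+ 2 = 0 by nra.
  by move/eqP; rewrite sqrf_eq0 subr_eq0 => /eqP.
exists g; split.
- move=> y d Gy; apply/eqP; rewrite eq_complex; apply/andP; split; apply/eqP.
    exact: key.
  (* The imaginary part is the real part at ['i *: y]. *)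
  have Gi : G ('i *: y + 0) ('i * d + 0) by exact: Glin.
  have := key _ _ Gi; rewrite !addr0 /rinner innerZl.
  case: <<| y, g |>> => ? ?; case: d {Gy Gi} => ? ? /=; lra.
- have h : hnorm g ^+ 2 <= M * hnorm g.
    apply: (@le_of_eps _ (hnorm g + M)) => e e0.
    have [x [c [Gx _ xg]]] := approx _ e0.
    have h1 := GM _ _ Gx; rewrite -(key _ _ Gx) in h1.
    have h2 := rinner_le (g - x) g.
    have h3 := hnormD_le (x - g) g; rewrite subrK in h3.
    have h4 := hnorm_ge0 g.
    move: h2; rewrite !rinnerE rinner_hnorm hnorm_distC => h2.
    have : hnorm (x - g) * hnorm g <= e * hnorm g by apply: ler_wpM2r => //; exact: ltW.
    have : M * hnorm x <= M * (e + hnorm g) by apply: ler_wpM2l => //; lra.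
    lra.
  have := hnorm_ge0 g; nra.
- by move=> e e0; have [x [c [Gx _ xg]]] := approx _ e0; exists x, c.
Qed.

End Riesz.

(** * Operator norms and adjoints *)

Section Operators.
Context {R : realType}.
Implicit Types E F : hilbertType R.

Lemma linear_0 E F (T : E -> F) : linear T -> T 0 = 0.
Proof. by move=> lT; have := lT (-1) 0 0; rewrite scaler0 addr0 scaleN1r addNr. Qed.

Lemma linear_D E F (T : E -> F) x y : linear T -> T (x + y) = T x + T y.
Proof. by move=> lT; rewrite -[x]scale1r lT !scale1r. Qed.

Lemma linear_Z E F (T : E -> F) a x : linear T -> T (a *: x) = a *: T x.
Proof. by move=> lT; rewrite -[a *: x]addr0 lT linear_0 // addr0. Qed.

Lemma linear_B E F (T : E -> F) x y : linear T -> T (x - y) = T x - T y.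
Proof. by move=> lT; rewrite linear_D // -scaleN1r linear_Z // scaleN1r. Qed.

Lemma opnorm_le E F (T : E -> F) M : 0 <= M ->
  (forall x, hnorm (T x) <= M * hnorm x) -> opnorm T <= M.
Proof.
move=> M0 TM; apply: ge_sup; first by exists (hnorm (T 0)), 0 => //=; rewrite hnorm0.
by move=> _ [x /= x1 <-]; apply: le_trans (TM x) _; rewrite ler_piMr.
Qed.

Lemma bounded_has_ubound E F (T : E -> F) : bounded_operator T ->
  has_ubound [set hnorm (T x) | x in [set x | hnorm x <= 1]].
Proof.
move=> [_ [M TM]]; exists `|M| => _ [x /= x1 <-]; apply: le_trans (TM x) _.
apply: (@le_trans _ _ (`|M| * hnorm x)); last by rewrite ler_piMr.
by rewrite ler_wpM2r ?hnorm_ge0 ?ler_norm.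
Qed.

Lemma hnorm_le_opnorm E F (T : E -> F) x :
  bounded_operator T -> hnorm (T x) <= opnorm T * hnorm x.
Proof.
move=> bT; have [lT _] := bT.
have [->|x0] := eqVneq x 0; first by rewrite linear_0 // !hnorm0 mulr0.
have h0 : 0 < hnorm x by rewrite lt_neqAle hnorm_ge0 eq_sym hnorm_eq0 x0.
rewrite -ler_pdivrMr // mulrC -[(hnorm x)^-1]gtr0_norm ?invr_gt0 //.
rewrite -hnormZ -linear_Z //; apply: ub_le_sup; first exact: bounded_has_ubound.
exists ((hnorm x)^-1%:C *: x) => //=.
by rewrite hnormZ gtr0_norm ?invr_gt0 // mulVf // gt_eqF.
Qed.

Lemma opnorm_ge0 E F (T : E -> F) : bounded_operator T -> 0 <= opnorm T.
Proof.
move=> bT; apply: (@le_trans _ _ (hnorm (T 0))); first exact: hnorm_ge0.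
apply: ub_le_sup; first exact: bounded_has_ubound.
by exists 0 => //=; rewrite hnorm0.
Qed.

Lemma inner_inj E (x y : E) : (forall z, <<| z, x |>> = <<| z, y |>>) -> x = y.
Proof.
move=> h; apply/eqP; rewrite -subr_eq0 -hnorm_eq0 -sqrf_eq0 -rinner_hnorm /rinner.
by rewrite innerBr h subrr.
Qed.

Lemma adjoint_unique E F (T : E -> F) y x :
  (forall z, <<| T z, y |>> = <<| z, x |>>) -> adjoint T y = x.
Proof.
move=> h; apply: inner_inj => z; rewrite -h /adjoint.
by case: xgetP => [w _ <-//|/(_ x)]; case.
Qed.

(** Riesz representation of [z |-> <T z, y>]. *)
Lemma adjointE E F (T : E -> F) z y :
  bounded_operator T -> <<| T z, y |>> = <<| z, adjoint T y |>>.
Proof.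
move=> bT; have [lT _] := bT.
have [||||g [gE _ _]] := @riesz_relation R E (fun x c => c = <<| T x, y |>>)
    (opnorm T * hnorm y).
- by rewrite mulr_ge0 ?opnorm_ge0 ?hnorm_ge0.
- by rewrite linear_0 // inner0l.
- by move=> a x x' _ _ -> ->; rewrite lT inner_linearl.
- move=> x _ ->; apply: le_trans (rinner_le _ _) _.
  by rewrite mulrAC ler_wpM2r ?hnorm_ge0 ?hnorm_le_opnorm.
by rewrite (@adjoint_unique _ _ T y g) => [|w]; rewrite (gE _ _ erefl).
Qed.

Lemma adjoint_linear E F (T : E -> F) : bounded_operator T -> linear (adjoint T).
Proof.
move=> bT a x y; apply: inner_inj => z.
by rewrite -adjointE // !(innerDr, innerZr) !adjointE.
Qed.

Lemma hnorm_adjoint_le E F (T : E -> F) y :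
  bounded_operator T -> hnorm (adjoint T y) <= opnorm T * hnorm y.
Proof.
move=> bT; set x := adjoint T y.
have h1 : hnorm x ^+ 2 <= hnorm (T x) * hnorm y.
  by rewrite -rinner_hnorm {2}/x /rinner -adjointE //; exact: rinner_le.
have h2 := hnorm_le_opnorm x bT.
have h3 : hnorm (T x) * hnorm y <= opnorm T * hnorm x * hnorm y.
  by rewrite ler_wpM2r ?hnorm_ge0.
have : 0 <= opnorm T * hnorm y by rewrite mulr_ge0 ?opnorm_ge0 ?hnorm_ge0.
have := hnorm_ge0 x; nra.
Qed.

Lemma adjoint_bounded E F (T : E -> F) :
  bounded_operator T -> bounded_operator (adjoint T).
Proof.
move=> bT; split; first exact: adjoint_linear.
by exists (opnorm T) => x; exact: hnorm_adjoint_le.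
Qed.

End Operators.

(** * Positive operators and square roots *)

Section Limits.
Context {R : realType} {E : hilbertType R}.
Implicit Types (u : nat -> E) (l x y : E).

Lemma hnorm_lim_le u l (c : R) :
  u n @[n --> \oo] --> l -> (forall n, hnorm (u n) <= c) -> hnorm l <= c.
Proof.
move=> /hnorm_cvgP ul uc; apply: (@le_of_eps _ 1) => e /ul[N hN].
have := hnorm_tri l (u N) 0; rewrite !subr0 hnorm_distC.
have := hN N (leqnn _); have := uc N; lra.
Qed.

Lemma rinner_lim_eq0 u l y :
  u n @[n --> \oo] --> l -> (forall n, rinner (u n) y = 0) -> rinner l y = 0.
Proof.
move=> /hnorm_cvgP ul uc; apply/eqP; rewrite -normr_le0.
apply: (@le_of_eps _ (hnorm y)) => e /ul[N hN].
have := rinner_abs_le (u N - l) y; rewrite !rinnerE uc add0r normrN => /le_trans.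
by apply; rewrite add0r ler_wpM2r ?hnorm_ge0 // ltW // hN.
Qed.

End Limits.

Section PositiveOperators.
Context {R : realType} {E : hilbertType R}.

(** Polarization: the quadratic form of [S] is real at [x + y] and at
    ['i *: x + y], which gives the imaginary and the real part of the claim. *)
Lemma positive_selfadjoint (S : E -> E) x y :
  positive_operator S -> <<| S x, y |>> = <<| x, S y |>>.
Proof.
move=> [[lS _] pS].
have im0 z : complex.Im <<| S z, z |>> = 0 by rewrite ger0_Im.
have sym z w : complex.Im (<<| S z, w |>> + <<| S w, z |>>) = 0.
  have := im0 (z + w); rewrite linear_D // !(innerDl, innerDr) !raddfD /= !im0.
  by rewrite add0r addr0.
have h1 := sym x y; have := sym ('i *: x) y.
rewrite linear_Z // innerZl innerZr (inner_conj (S y) x).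
move: h1; case: <<| S x, y |>> => a b; case: <<| S y, x |>> => c d /= h1 h2.
by congr Complex; lra.
Qed.

(** [nonneg_poly B Y s]: [Y] is the value at [B], and [s] the value at 1, of one
    polynomial with nonnegative coefficients. The generating rules stand for the
    polynomial, so that each property of the pair needs only an induction on
    them. *)
Inductive nonneg_poly (B : E -> E) : (E -> E) -> R -> Prop :=
| NonnegPoly0 : nonneg_poly B (fun=> 0) 0
| NonnegPolyX : nonneg_poly B B 1
| NonnegPolyD a Y s Z t : 0 <= a -> nonneg_poly B Y s -> nonneg_poly B Z t ->
    nonneg_poly B (fun x => a%:C *: Y x + Z x) (a * s + t)
| NonnegPolyM Y s Z t : nonneg_poly B Y s -> nonneg_poly B Z t ->
    nonneg_poly B (fun x => Y (Z x)) (s * t).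

Section SquareRoot.
Variable B : E -> E.
Hypotheses (linB : linear B) (B_le : forall x, hnorm (B x) <= hnorm x)
  (B_adj : forall x y, <<| B x, y |>> = <<| x, B y |>>).

Lemma nonneg_poly_linear Y s : nonneg_poly B Y s -> linear Y.
Proof.
elim=> //= {Y s}.
- by move=> a x y; rewrite scaler0 addr0.
- move=> a Y s Z t _ _ lY _ lZ b x y; rewrite lY lZ !scalerDr !scalerA mulrC.
  by rewrite addrACA.
- by move=> Y s Z t _ lY _ lZ b x y; rewrite lZ lY.
Qed.

(** Nonnegativity of the coefficients turns [|B| <= 1] into [|Y| <= s]. *)
Lemma nonneg_poly_le Y s : nonneg_poly B Y s ->
  0 <= s /\ forall x, hnorm (Y x) <= s * hnorm x.
Proof.
elim=> //= {Y s}.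
- by split=> // x; rewrite hnorm0 mul0r.
- by split=> // x; rewrite mul1r.
- move=> a Y s Z t a0 _ [s0 hY] _ [t0 hZ]; split; first by rewrite addr_ge0 ?mulr_ge0.
  move=> x; apply: le_trans (hnormD_le _ _) _; rewrite hnormZ ger0_norm // mulrDl.
  by rewrite lerD // -mulrA ler_wpM2l.
- move=> Y s Z t _ [s0 hY] _ [t0 hZ]; split; first by rewrite mulr_ge0.
  by move=> x; apply: le_trans (hY _) _; rewrite -mulrA ler_wpM2l.
Qed.

Lemma nonneg_poly_comm_of Y s Z : nonneg_poly B Y s -> linear Z ->
  (forall x, B (Z x) = Z (B x)) -> forall x, Y (Z x) = Z (Y x).
Proof.
move=> hY lZ BZ; elim: hY => //= {Y s}.
- by move=> x; rewrite linear_0.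
- by move=> a Y s W t _ _ hY _ hW x; rewrite lZ hY hW.
- by move=> Y s W t _ hY _ hW x; rewrite hW hY.
Qed.

Lemma nonneg_poly_comm Y s Z t : nonneg_poly B Y s -> nonneg_poly B Z t ->
  forall x, Y (Z x) = Z (Y x).
Proof.
move=> hY hZ; apply: (nonneg_poly_comm_of hY); first exact: nonneg_poly_linear hZ.
by move=> x; rewrite (nonneg_poly_comm_of hZ).
Qed.

Lemma nonneg_poly_adj Y s : nonneg_poly B Y s ->
  forall x y, <<| Y x, y |>> = <<| x, Y y |>>.
Proof.
elim=> //= {Y s}.
- by move=> x y; rewrite inner0l inner0r.
- by move=> a Y s Z t _ _ hY _ hZ x y; rewrite inner_linearl innerDr innerZr hY hZ conjc_real.
- by move=> Y s Z t hY aY hZ aZ x y; rewrite aY aZ (nonneg_poly_comm hY hZ).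
Qed.

(** If [S = 1 - Y] squares to [1 - B] then [Y = (B + Y ^ 2) / 2]; [sqrt_iter]
    iterates this equation from 0, and [sqrt_bound] follows its value at 1. *)
Fixpoint sqrt_iter n : E -> E :=
  if n is m.+1 then fun x => 2^-1%:C *: B x + 2^-1%:C *: sqrt_iter m (sqrt_iter m x)
  else fun=> 0.

Fixpoint sqrt_bound n : R :=
  if n is m.+1 then 2^-1 * 1 + 2^-1 * (sqrt_bound m * sqrt_bound m) else 0.

Lemma nonneg_polyZ a Y s : 0 <= a -> nonneg_poly B Y s ->
  nonneg_poly B (fun x => a%:C *: Y x) (a * s).
Proof.
move=> a0 hY; have := NonnegPolyD a0 hY (NonnegPoly0 B); rewrite addr0.
by under eq_fun do rewrite addr0.
Qed.

Lemma sqrt_iter_poly n : nonneg_poly B (sqrt_iter n) (sqrt_bound n).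
Proof.
elim: n => [|n IHn] /=; first exact: NonnegPoly0.
by apply: NonnegPolyD (NonnegPolyX _) (nonneg_polyZ _ (NonnegPolyM IHn IHn)).
Qed.

(** The increments have nonnegative coefficients again, because
    [Y' ^ 2 - Y ^ 2 = (Y' - Y) (Y' + Y)] for commuting [Y] and [Y']. Their norms
    are therefore bounded by the increments of a convergent real sequence. *)
Lemma sqrt_iter_step n :
  nonneg_poly B (fun x => sqrt_iter n.+1 x - sqrt_iter n x)
    (sqrt_bound n.+1 - sqrt_bound n).
Proof.
elim: n => [|n IHn].
  rewrite /= !mulr0 addr0 subr0.
  under eq_fun do rewrite subr0 scaler0 addr0.
  exact: nonneg_polyZ (NonnegPolyX _).
have hY := sqrt_iter_poly n; have hZ := sqrt_iter_poly n.+1.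
have half : 0 <= 2^-1 :> R by [].
have := nonneg_polyZ half (NonnegPolyM IHn (NonnegPolyD ler01 hZ hY)).
congr (nonneg_poly B _ _); last by rewrite /=; ring.
apply: funext => x; rewrite scale1r.
have lY := nonneg_poly_linear hY; have lZ := nonneg_poly_linear hZ.
rewrite (linear_D _ _ lY) (linear_D _ _ lZ) (nonneg_poly_comm hY hZ).
have -> : sqrt_iter n.+2 x - sqrt_iter n.+1 x =
    2^-1%:C *: sqrt_iter n.+1 (sqrt_iter n.+1 x) - 2^-1%:C *: sqrt_iter n (sqrt_iter n x).
  by rewrite [X in _ - X = _]/= opprD addrACA subrr add0r.
rewrite -scalerBr; congr (_ *: _).
by rewrite opprD addrA addrK.
Qed.

Lemma sqrt_bound_le1 n : sqrt_bound n <= 1.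
Proof.
elim: n => [|n IHn] /=; first exact: ler01.
have [s0 _] := nonneg_poly_le (sqrt_iter_poly n); nra.
Qed.

Lemma sqrt_iter_dist n m x : (n <= m)%N ->
  hnorm (sqrt_iter n x - sqrt_iter m x) <= (sqrt_bound m - sqrt_bound n) * hnorm x.
Proof.
elim: m => [|m IHm]; first by rewrite leqn0 => /eqP->; rewrite !subrr hnorm0 mul0r.
rewrite leq_eqVlt => /predU1P[->|]; first by rewrite !subrr hnorm0 mul0r.
rewrite ltnS => /IHm {}IHm; have [_ /(_ x)] := nonneg_poly_le (sqrt_iter_step m).
rewrite hnorm_distC => h; apply: le_trans (hnorm_tri _ (sqrt_iter m x) _) _.
by apply: le_trans (lerD IHm h) _; rewrite -mulrDl [X in X * _ <= _]addrC addrA subrK.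
Qed.

Lemma sqrt_bound_cauchy e : 0 < e ->
  exists N, forall n, (N <= n)%N -> sqrt_bound n - sqrt_bound N < e.
Proof.
move=> e0; pose V := range sqrt_bound.
have V0 : V !=set0 by exists (sqrt_bound 0), 0%N.
have Vub : has_ubound V by exists 1 => _ [n _ <-]; exact: sqrt_bound_le1.
have [_ [N _ <-] hN] := sup_adherent e0 (conj V0 Vub).
exists N => n _; have : sqrt_bound n <= sup V by apply: ub_le_sup => //; exists n.
lra.
Qed.

(** The iterates converge pointwise to a solution [Y] of [2 Y = B + Y ^ 2] which is
    a symmetric contraction, so [1 - Y] is a positive square root of [1 - B]. *)
Lemma sqrt_exists :
  exists S, positive_operator S /\ forall x, S (S x) = x - B x.
Proof.
have /choice [Y hY] : forall x, exists l : E, sqrt_iter n x @[n --> \oo] --> l.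
  move=> x; apply: hnorm_cauchy => e e0.
  have x1 : 0 < hnorm x + 1 by have := hnorm_ge0 x; lra.
  have [|N hN] := @sqrt_bound_cauchy (e / (hnorm x + 1)); first by rewrite divr_gt0.
  exists N => n Nn; apply: le_lt_trans (sqrt_iter_dist x Nn) _.
  have := hN n Nn; rewrite ltr_pdivlMr //.
  have : 0 <= sqrt_bound n - sqrt_bound N.
    elim: n Nn {hN} => [|n IHn]; first by rewrite leqn0 => /eqP->; rewrite subrr.
    rewrite leq_eqVlt => /predU1P[<-|]; first by rewrite subrr.
    rewrite ltnS => /IHn; have [+ _] := nonneg_poly_le (sqrt_iter_step n); lra.
  lra.
have lY : linear Y.
  move=> a x y; apply: (cvg_unique _ (hY _)); first exact: norm_hausdorff.
  have -> : (fun n => sqrt_iter n (a *: x + y)) =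
      (fun n => a *: sqrt_iter n x + sqrt_iter n y).
    by apply: funext => n; rewrite (nonneg_poly_linear (sqrt_iter_poly _)).
  by apply: cvgD; [apply: cvgZl_tmp; exact: hY | exact: hY].
have Y_le n x : hnorm (sqrt_iter n x) <= hnorm x.
  have [_ /(_ x) h] := nonneg_poly_le (sqrt_iter_poly n).
  by apply: le_trans h _; rewrite ler_piMl ?hnorm_ge0 ?sqrt_bound_le1.
have Yfix x : Y x + Y x = B x + Y (Y x).
  apply/eqP; rewrite -subr_eq0 -hnorm_eq0 -[_ == _]andbT eq_le hnorm_ge0 !andbT.
  apply: (@le_of_eps _ 4) => e e0; rewrite add0r.
  have /hnorm_cvgP/(_ _ e0)[N hN] := hY x.
  have /hnorm_cvgP/(_ _ e0)[N' hN'] := hY (Y x).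
  pose n := maxn N N'; pose Z := sqrt_iter n.
  have h1 : hnorm (sqrt_iter n.+1 x - Y x) < e by rewrite hN // leqW ?leq_maxl.
  have h2 : hnorm (Z x - Y x) < e by rewrite hN // leq_maxl.
  have h3 : hnorm (Z (Y x) - Y (Y x)) < e by rewrite hN' // leq_maxr.
  have h4 := Y_le n (Z x - Y x).
  rewrite (linear_B _ _ (nonneg_poly_linear (sqrt_iter_poly n))) -/Z in h4.
  have -> : Y x + Y x - (B x + Y (Y x)) =
      (-2)%:C *: (sqrt_iter n.+1 x - Y x)
      + ((Z (Z x) - Z (Y x)) + (Z (Y x) - Y (Y x))).
    rewrite /= -/Z scalerBr scalerDr !scalerA -!rmorphM /= mulNr divff // rmorphN1 !scaleN1r.
    rewrite rmorphN scaleNr opprK rmorphD /= scalerDl scale1r.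
    rewrite [Z (Z x) - _ + _]addrA subrK [RHS]addrACA subrK opprD.
    exact: addrCA.
  apply: le_trans (hnormD_le _ _) _; rewrite hnormZ normrN ger0_norm //.
  apply: (@le_trans _ _ (2 * e + (e + e))); last lra.
  rewrite lerD ?ler_wpM2l ?(ltW h1) //; apply: le_trans (hnormD_le _ _) _.
  by rewrite lerD ?(ltW h3) // (le_trans h4) // ltW.
exists (fun x => x - Y x); split; last first.
  move=> x; rewrite linear_B // opprB addrACA -opprD Yfix [B x + _]addrC.
  by rewrite opprD addrA addrK.
have Yn x : hnorm (Y x) <= hnorm x by apply: hnorm_lim_le (hY x) _ => n; exact: Y_le.
split.
  split; first by move=> a x y; rewrite lY scalerBr opprD addrACA.
  exists 2 => x; apply: le_trans (hnormD_le _ _) _; rewrite hnorm_opp.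
  by have := Yn x; lra.
move=> x; rewrite lecE innerBl inner_hnorm !raddfB /=; apply/andP; split.
  rewrite sub0r oppr_eq0; apply/eqP.
  have im z : complex.Im <<| z, x |>> = rinner z ('i *: x).
    by rewrite /rinner innerZr; case: <<| z, x |>> => ? ? /=; lra.
  rewrite im; apply: rinner_lim_eq0 (hY x) _ => n.
  rewrite -im; have := nonneg_poly_adj (sqrt_iter_poly n) x x.
  by rewrite (inner_conj (sqrt_iter n x) x); case: <<| _, _ |>> => a b /= [] ; lra.
rewrite subr_ge0 expr2; apply: le_trans (rinner_le (Y x) x) _.
by rewrite ler_wpM2r ?hnorm_ge0.
Qed.

End SquareRoot.
End PositiveOperators.

(** * The defect operator *)

Section Defect.
Context {R : realType} {E : hilbertType R}.

Lemma defectP (A : E -> E) : bounded_operator A -> opnorm A <= 1 ->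
  positive_operator (defect A) /\
  forall x, defect A (defect A x) = x - adjoint A (A x).
Proof.
move=> bA A1; have [lA _] := bA.
have Ax x : hnorm (A x) <= hnorm x.
  by apply: le_trans (hnorm_le_opnorm x bA) _; rewrite ler_piMl ?hnorm_ge0.
apply: (@xgetPex _ (fun=> 0)
  [set S : E -> E | positive_operator S /\ forall x, S (S x) = x - adjoint A (A x)]).
apply: (@sqrt_exists R E (fun x => adjoint A (A x))).
- by move=> a x y; rewrite lA adjoint_linear.
- move=> x; apply: le_trans (hnorm_adjoint_le _ bA) _.
  apply: (@le_trans _ _ (hnorm (A x))) => //.
  by rewrite ler_piMl ?hnorm_ge0.
- by move=> x y; rewrite -adjointE // inner_conj -adjointE // -inner_conj.
Qed.

End Defect.

Section MinNorm.
Context {R : realType} {E : hilbertType R}.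

(** Representing [<., v>] on the range of [S] gives a vector [g] in the closure of
    that range with [S g = S v]. Then [v - g] is orthogonal to [g], so that
    [|v|^2 = |g|^2 + |v - g|^2], and minimality of [|v|] forces [g = v]. *)
Lemma min_norm_in_closure (S : E -> E) (y v : E) :
  positive_operator S -> is_min_norm_solution S y v ->
  forall e : R, 0 < e -> exists z, hnorm (S z - v) < e.
Proof.
move=> pS [Sv vmin]; have [[lS _] _] := pS.
have [||||g [gE gv gS]] := @riesz_relation R E
    (fun x c => exists z, x = S z /\ c = <<| S z, v |>>) (hnorm v).
- exact: hnorm_ge0.
- by exists 0; rewrite linear_0 // inner0l.
- by move=> a _ _ _ _ [z [-> ->]] [w [-> ->]]; exists (a *: z + w); rewrite lS inner_linearl.
- by move=> _ _ [z [-> ->]]; rewrite mulrC; exact: rinner_le.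
have {}gE z : <<| S z, g |>> = <<| S z, v |>> by apply: gE; exists z.
have Sg : S g = y.
  by rewrite -Sv; apply: inner_inj => z; rewrite -!positive_selfadjoint // gE.
have ort : rinner g (v - g) = 0.
  apply/eqP; rewrite -normr_le0; apply: (@le_of_eps _ (hnorm (v - g))) => e e0.
  have [_ [_ [[z [-> _]] zg]]] := gS e e0; rewrite add0r.
  have -> : rinner g (v - g) = rinner (g - S z) (v - g).
    rewrite [RHS]rinnerDl rinnerNl [rinner (S z) _](_ : _ = 0) ?subr0 //.
    by rewrite /rinner innerBr gE subrr.
  apply: le_trans (rinner_abs_le _ _) _.
  by rewrite ler_wpM2r ?hnorm_ge0 // hnorm_distC ltW.
have : hnorm (v - g) == 0.
  have := hnormD2 g (v - g); rewrite ort addrC subrK.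
  have := vmin _ Sg; have := hnorm_ge0 v; have := hnorm_ge0 (v - g); nra.
rewrite hnorm_eq0 subr_eq0 => /eqP-> e e0.
by have [_ [_ [[z [-> _]] zg]]] := gS e e0; exists z.
Qed.

End MinNorm.

(** If [T^*] attains its norm [m] at [x] then [y = T^* x / m] is a unit vector and
    [|T y| >= Re <T y, x> = Re <y, T^* x> = m], which is also the norm of [T]. *)
Lemma norm_attaining_of_adjoint (R : realType) (E F : hilbertType R) (T : E -> F) :
  bounded_operator T -> 0 < opnorm T -> norm_attaining (adjoint T) -> norm_attaining T.
Proof.
move=> bT T0 [x [_ x1 xT]]; have [lT _] := bT.
have bT' := adjoint_bounded bT; set m := opnorm (adjoint T) in xT.
have m0 : 0 <= m by exact: opnorm_ge0.
have Tm : opnorm T <= m.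
  apply: opnorm_le => // y; have := hnorm_le_opnorm (T y) bT'; rewrite -/m.
  have := rinner_le y (adjoint T (T y)); rewrite /rinner -adjointE // -/(rinner _ _) rinner_hnorm.
  have := hnorm_ge0 y; have := hnorm_ge0 (T y).
  set a := hnorm (T y); set d := hnorm y; set f := hnorm _ => a0 d0 h1 h2.
  have : d * f <= d * (m * a) by rewrite ler_wpM2l.
  have : 0 <= m * d by rewrite mulr_ge0.
  nra.
have mT : m <= opnorm T by apply: opnorm_le (ltW T0) _ => y; exact: hnorm_adjoint_le.
have m1 : 0 < m by apply: lt_le_trans Tm.
pose y := m^-1%:C *: adjoint T x.
have y1 : hnorm y = 1 by rewrite hnormZ xT gtr0_norm ?invr_gt0 // mulVf // gt_eqF.
exists y; split => //; apply/eqP; rewrite eq_le; apply/andP; split.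
  by have := hnorm_le_opnorm y bT; rewrite y1 mulr1.
apply: le_trans Tm _; have := rinner_le (T y) x; rewrite x1 mulr1; apply: le_trans.
rewrite /rinner adjointE // -/(rinner _ _) rinnerZl rinner_hnorm xT expr2 mulrA.
by rewrite mulVf ?mul1r // gt_eqF.
Qed.

(** * The Schur product theorem for Gram matrices *)

Section Schur.
Context {R : realType} {F G : hilbertType R}.

(** Splitting off from all [u i] their components along one vector [u k] removes
    from the sum a multiple of a square norm; the remaining vectors vanish at
    [k], so induction on the set of indices where [u] may be nonzero applies.
    Coefficients are absorbed in [f]. *)
Lemma schur_gram_ge0 (I : eqType) (s : seq I) (f : I -> F) (u : I -> G) :
  0 <= \sum_(i <- s) \sum_(j <- s) <<| f i, f j |>> * <<| u i, u j |>>.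
Proof.
(* [t] lists the indices where [u] may be nonzero. *)
suff H (t : seq I) : (forall i, i \in s -> i \notin t -> u i = 0) ->
    0 <= \sum_(i <- s) \sum_(j <- s) <<| f i, f j |>> * <<| u i, u j |>>.
  by apply: (H s) => i si; rewrite si.
elim: t u => [|k t IHt] u ut.
  rewrite big_seq big1 // => i si; rewrite big1 // => j _.
  by rewrite (ut i) // inner0l mulr0.
have [uk0|uk0] := eqVneq (u k) 0.
  apply: IHt => i si it; have [->//|ik] := eqVneq i k.
  by apply: ut; rewrite // inE negb_or ik.
pose n := <<| u k, u k |>>.
have n0 : 0 < n by rewrite /n inner_norm exprn_gt0 ?normr_gt0.
have nn : n != 0 by rewrite gt_eqF.
have nc : conjc n = n by rewrite -inner_conj.
pose a i := <<| u i, u k |>>.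
pose w i := u i - (a i / n) *: u k.
have uE i j : <<| u i, u j |>> = <<| w i, w j |>> + n^-1 * (a i * conjc (a j)).
  rewrite /w innerBl !innerBr !innerZl !innerZr -/n -/(a i) (inner_conj (u j) (u k)) -/(a j).
  by rewrite rmorphM rmorphV ?unitfE //= nc; field.
under eq_bigr do under eq_bigr do rewrite uE mulrDr.
under eq_bigr do rewrite big_split.
rewrite big_split /= addr_ge0 //.
  apply: IHt => i si it; rewrite /w; have [->|ik] := eqVneq i k.
    by rewrite /a -/n divff // scale1r subrr.
  by rewrite /a ut ?inE ?negb_or ?ik // inner0l mul0r scale0r subrr.
suff -> : \sum_(i <- s) \sum_(j <- s) <<|f i, f j|>> * (n^-1 * (a i * conjc (a j))) =
    n^-1 * <<| \sum_(i <- s) a i *: f i, \sum_(i <- s) a i *: f i |>>.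
  by rewrite inner_norm mulr_ge0 ?invr_ge0 ?(ltW n0) // exprn_ge0.
rewrite inner_suml mulr_sumr; apply: eq_bigr => i _.
rewrite inner_sumr mulr_sumr; apply: eq_bigr => j _.
by rewrite innerZl innerZr; ring.
Qed.

End Schur.

(** * Composition operators on reproducing kernel Hilbert spaces *)

Section Kernels.
Context {R : realType} {X : Type} {K : X -> X -> R[i]} (H : rkhs K).
Local Notation k := (rkhs_kernel H).

Lemma rkhs_kernel_inner z w : <<| k z, k w |>> = K w z.
Proof. by rewrite rkhs_reproducing rkhs_kernelE. Qed.

Variables (phi : X -> X) (M : R).
Hypotheses (M0 : 0 <= M)
  (phiM : forall s : seq (R[i] * X),
    hnorm (\sum_(p <- s) p.1 *: k (phi p.2)) <= M * hnorm (\sum_(p <- s) p.1 *: k p.2)).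

(** [K_z |-> K_(phi z)] is bounded by [M] on the span of the kernels. The relation
    pairing [sum c K_z] with [<sum c K_(phi z), f>] is thus bounded, and the
    vector [g] representing it satisfies [<K_z, g> = <K_(phi z), f>], which by
    the reproducing property is [g = f o phi]. *)
Lemma composition_exists (f : H) :
  exists g : H, rkhs_fun g = rkhs_fun f \o phi /\ hnorm g <= M * hnorm f.
Proof.
have [||||g [gE gM _]] := @riesz_relation R H
    (fun x c => exists s : seq (R[i] * X), x = \sum_(p <- s) p.1 *: k p.2 /\
      c = <<| \sum_(p <- s) p.1 *: k (phi p.2), f |>>) (M * hnorm f).
- by rewrite mulr_ge0 ?hnorm_ge0.
- by exists [::]; rewrite !big_nil inner0l.
- move=> a _ _ _ _ [s [-> ->]] [t [-> ->]].
  exists ([seq (a * p.1, p.2) | p <- s] ++ t); rewrite !big_cat !big_map /= -inner_linearl.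
  by rewrite !scaler_sumr; split; [|congr (<<| _ + _, _ |>>)];
    first (congr (_ + _)); apply: eq_bigr => p _; rewrite scalerA.
- move=> _ _ [s [-> ->]]; apply: le_trans (rinner_le _ _) _.
  by rewrite mulrAC ler_wpM2r ?hnorm_ge0.
exists g; split=> //; apply: funext => z /=.
rewrite -!rkhs_reproducing inner_conj (gE _ <<| k (phi z), f |>>) -?inner_conj //.
by exists [:: (1, z)]; rewrite !big_seq1 !scale1r.
Qed.

Local Notation C := (composition_operator phi : H -> H).

Lemma composition_funE (f : H) : rkhs_fun (C f) = rkhs_fun f \o phi.
Proof.
by apply: composition_operatorE; have [g [gE _]] := composition_exists f; exists g.
Qed.

Lemma hnorm_composition_le (f : H) : hnorm (C f) <= M * hnorm f.
Proof.
have [g [gE gM]] := composition_exists f.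
by rewrite (_ : C f = g) //; apply: rkhs_fun_inj; rewrite composition_funE gE.
Qed.

Lemma composition_bounded : bounded_operator C.
Proof.
split; last by exists M; exact: hnorm_composition_le.
move=> a f g; apply: rkhs_fun_inj; rewrite composition_funE; apply: funext => z.
by rewrite /= !rkhs_fun_linear !composition_funE.
Qed.

Lemma adjoint_composition_kernel z : adjoint C (k z) = k (phi z).
Proof.
by apply: adjoint_unique => f; rewrite !rkhs_reproducing composition_funE.
Qed.

End Kernels.

(** * The Segal-Bargmann space *)

Section ComplexExponential.
Context {R : realType}.
Implicit Types z w : R[i].

Lemma cexpD z w : cexp (z + w) = cexp z * cexp w.
Proof.
case: z w => a b [c d]; rewrite /cexp /= expRD cosD sinD.
by apply/eqP; rewrite eq_complex /=; apply/andP; split; apply/eqP; ring.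
Qed.

Lemma cexp_real (t : R) : cexp t%:C = (expR t)%:C.
Proof. by rewrite /cexp /= cos0 sin0 mulr1. Qed.

End ComplexExponential.

Section SegalBargmann.
Context {R : realType} {E : hilbertType R} (H : segal_bargmann E).
Local Notation k := (rkhs_kernel H).

Lemma segal_bargmann_inner z w : <<| k z, k w |>> = cexp <<| w, z |>>.
Proof. exact: rkhs_kernel_inner. Qed.

Lemma hnorm_kernel2 z : hnorm (k z) ^+ 2 = expR (hnorm z ^+ 2).
Proof. by apply: complexI; rewrite -inner_hnorm segal_bargmann_inner inner_hnorm cexp_real. Qed.

Variables (phi u : E -> E) (c : R).
Hypothesis phi_u : forall z w,
  <<| phi z, phi w |>> + <<| u z, u w |>> = <<| z, w |>> + c%:C.

(** By the hypothesis on [phi] and [u], [exp c] times the Gram matrix of the [K_z]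
    minus that of the [K_(phi z)] is the entrywise product of the Gram matrices
    of the [K_(phi z)] and of the [K_(u z) - K_0]. *)
Lemma kernel_sum_le (s : seq (R[i] * E)) :
  hnorm (\sum_(p <- s) p.1 *: k (phi p.2)) <=
  expR (c / 2) * hnorm (\sum_(p <- s) p.1 *: k p.2).
Proof.
set x := \sum_(p <- s) _; set y := \sum_(p <- s) _.
suff : hnorm x ^+ 2 <= (expR (c / 2) * hnorm y) ^+ 2.
  by rewrite ler_pXn2r // nnegrE ?mulr_ge0 ?expR_ge0 ?hnorm_ge0.
rewrite exprMn [expR _ ^+ 2]expr2 -expRD -splitr -subr_ge0 -ler0c.
rewrite rmorphB rmorphM /= -!inner_hnorm.
have := schur_gram_ge0 s (fun p => p.1 *: k (phi p.2)) (fun p => k (u p.2) - k 0).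
congr (0 <= _).
rewrite /x /y !inner_suml mulr_sumr -sumrB; apply: eq_bigr => p _.
rewrite !inner_sumr mulr_sumr -sumrB; apply: eq_bigr => q _.
rewrite !innerZl !innerZr innerBl !innerBr !segal_bargmann_inner !inner0l !inner0r.
rewrite (cexp_real 0) expR0.
have := congr1 cexp (phi_u q.2 p.2); rewrite !cexpD cexp_real => h.
ring: h.
Qed.

Local Notation C := (composition_operator phi : H -> H).
Let M0 := expR_ge0 (c / 2).

Lemma segal_bargmann_bounded : bounded_operator C.
Proof. exact: composition_bounded M0 kernel_sum_le. Qed.

Lemma hnorm_kernel_neq0 z : hnorm (k z) != 0.
Proof. by rewrite -sqrf_eq0 hnorm_kernel2 gt_eqF ?expR_gt0. Qed.

Lemma normalized_kernelE z : normalized_kernel H z = (hnorm (k z))^-1%:C *: k z.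
Proof. by rewrite /normalized_kernel -hnormE fmorphV. Qed.

Lemma hnorm_normalized_kernel z : hnorm (normalized_kernel H z) = 1.
Proof.
rewrite normalized_kernelE hnormZ ger0_norm ?invr_ge0 ?hnorm_ge0 //.
by rewrite mulVf ?hnorm_kernel_neq0.
Qed.

Lemma hnorm_adjoint_normalized_kernel z :
  hnorm (adjoint C (normalized_kernel H z)) = expR ((c - hnorm (u z) ^+ 2) / 2).
Proof.
have bC' := adjoint_bounded segal_bargmann_bounded.
have [lC' _] := bC'.
rewrite normalized_kernelE linear_Z // (adjoint_composition_kernel M0 kernel_sum_le) hnormZ.
rewrite ger0_norm ?invr_ge0 ?hnorm_ge0 //.
apply/eqP; rewrite -(@eqrXn2 _ 2) ?mulr_ge0 ?invr_ge0 ?hnorm_ge0 ?expR_ge0 //.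
rewrite exprMn exprVn !hnorm_kernel2 [expR (_ / 2) ^+ 2]expr2 -expRD -splitr -expRN -expRD.
apply/eqP; congr expR; have := phi_u z z; rewrite !inner_hnorm -!rmorphD => /complexI; lra.
Qed.

(** The normalized kernels give the lower bound: they realise the values
    [exp ((c - |u z|^2) / 2)], and [u] takes arbitrarily small values. *)
Lemma opnorm_adjoint_composition :
  (forall e : R, 0 < e -> exists z, hnorm (u z) < e) ->
  opnorm (adjoint C) = expR (c / 2).
Proof.
move=> hu; have bC := segal_bargmann_bounded; have bC' := adjoint_bounded bC.
apply/eqP; rewrite eq_le; apply/andP; split.
  apply: opnorm_le => // x; apply: le_trans (hnorm_adjoint_le _ bC) _.
  rewrite ler_wpM2r ?hnorm_ge0 //; apply: opnorm_le => // f.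
  exact: hnorm_composition_le M0 kernel_sum_le _.
apply: (@le_of_eps _ (expR (c / 2) / 2)) => e e0.
(* With [|u z|] below both [e] and 1, also [|u z| ^ 2 <= e]. *)
have [|z zu] := hu (Num.min e 1); first by rewrite lt_min e0 ltr01.
have := hnorm_le_opnorm (normalized_kernel H z) bC'.
rewrite hnorm_normalized_kernel mulr1 hnorm_adjoint_normalized_kernel mulrBl expRD.
have := expR_ge1Dx (- (hnorm (u z) ^+ 2 / 2)).
have : hnorm (u z) ^+ 2 <= e.
  move: zu; rewrite lt_min => /andP[? ?]; have := hnorm_ge0 (u z); nra.
have := expR_gt0 (c / 2); nra.
Qed.

Lemma adjoint_attains_at_kernelP z :
  (forall e : R, 0 < e -> exists z, hnorm (u z) < e) ->
  attains_norm_at (adjoint C) (normalized_kernel H z) <-> u z = 0.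
Proof.
move=> hu; have bC' := adjoint_bounded segal_bargmann_bounded.
split=> [[_ _]|uz].
  rewrite hnorm_adjoint_normalized_kernel opnorm_adjoint_composition // => /expR_inj h.
  by apply/eqP; rewrite -hnorm_eq0 -sqrf_eq0; apply/eqP; lra.
split=> //; first exact: hnorm_normalized_kernel.
by rewrite hnorm_adjoint_normalized_kernel opnorm_adjoint_composition // uz hnorm0 expr0n subr0.
Qed.

End SegalBargmann.

(** * Affine symbols with property P *)

Section PropertyP.
Context {R : realType} {E : hilbertType R}.
Variables (phi A : E -> E) (b v : E).
Hypotheses (hP : property_P phi A b)
  (hv : is_min_norm_solution (defect A) (adjoint A b) v).

Lemma defect_inner z w :
  bounded_operator A -> opnorm A <= 1 ->
  <<| A z, A w |>> + <<| defect A z, defect A w |>> = <<| z, w |>>.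
Proof.
move=> bA A1; have [pS SS] := defectP bA A1.
by rewrite (positive_selfadjoint z _ pS) SS adjointE // innerBr addrC subrK.
Qed.

Lemma affine_defect_inner z w :
  <<| phi z, phi w |>> + <<| defect A z - v, defect A w - v |>> =
  <<| z, w |>> + (hnorm v ^+ 2 + hnorm b ^+ 2)%:C.
Proof.
have [phiE bA A1 _] := hP; have [pS _] := defectP bA A1; have [Sv _] := hv.
have key x : <<| A x, b |>> = <<| defect A x, v |>>.
  by rewrite adjointE // -Sv -positive_selfadjoint.
rewrite !phiE -(defect_inner z w bA A1) rmorphD /= -!inner_hnorm.
rewrite !(innerDl, innerDr, innerNl, innerNr) key.
by rewrite (inner_conj (A w) b) key -inner_conj; ring.
Qed.

End PropertyP.

Theorem theorem3p4 (R : realType) (E : hilbertType R) (H : segal_bargmann E)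
    (phi A : E -> E) (b v : E)
    (hP : property_P phi A b)
    (hv : is_min_norm_solution (defect A) (adjoint A b) v) :
  let C : H -> H := composition_operator phi in
  [/\ forall z : E,
        attains_norm_at (adjoint C) (normalized_kernel H z) <->
        v = defect A z,
      range (defect A) v -> norm_attaining C &
      (forall z : E, attains_norm_at (adjoint C) (normalized_kernel H z)) <->
      isometric A].
Proof.
move=> C; have [_ bA A1 _] := hP; have [pS _] := defectP bA A1.
have [[lS _] _] := pS; have [Sv vmin] := hv.
have phi_u := affine_defect_inner hP hv.
have hu := min_norm_in_closure pS hv.
have attainsP z : attains_norm_at (adjoint C) (normalized_kernel H z) <-> v = defect A z.
  split=> [/(adjoint_attains_at_kernelP H phi_u z hu)/eqP|vz].
    by rewrite subr_eq0 => /eqP.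
  by apply/(adjoint_attains_at_kernelP H phi_u z hu); rewrite vz subrr.
have AS z : hnorm (A z) ^+ 2 + hnorm (defect A z) ^+ 2 = hnorm z ^+ 2.
  by apply: complexI; rewrite rmorphD /= -!inner_hnorm defect_inner.
have bC : bounded_operator C := segal_bargmann_bounded H phi_u.
split=> //.
- move=> [z _ zv]; apply: norm_attaining_of_adjoint => //; last first.
    by exists (normalized_kernel H z); apply/attainsP.
  have := opnorm_adjoint_composition H phi_u hu; rewrite -/C => oC.
  apply: lt_le_trans (expR_gt0 ((hnorm v ^+ 2 + hnorm b ^+ 2) / 2)) _.
  rewrite -oC; apply: opnorm_le; first exact: opnorm_ge0.
  by move=> x; exact: hnorm_adjoint_le.
- split=> [h z|iA z].
    have v0 : v = 0 by have /attainsP := h 0; rewrite linear_0.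
    have /attainsP vz := h z; have := AS z; rewrite -vz v0 hnorm0 expr0n addr0.
    by move/eqP; rewrite eqrXn2 ?hnorm_ge0 // => /eqP.
  have S0 x : defect A x = 0.
    apply/eqP; rewrite -hnorm_eq0 -sqrf_eq0; apply/eqP.
    by have := AS x; rewrite iA; lra.
  apply/attainsP; rewrite S0; apply/eqP; rewrite -hnorm_eq0 eq_le hnorm_ge0 andbT.
  by have := vmin 0; rewrite hnorm0; apply; rewrite -Sv !S0.
Qed.
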